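(* Let $n\in\mathbb N$, $n\ge 1$, and let $\mathbb B_n=n\times\mathbb Q$ with $\langle i_1,q_1\rangle<\langle i_2,q_2\rangle$ iff $i_1=i_2$ and $q_1<_{\mathbb Q}q_2$. For each $\mathbb R$-embeddable complete linear order $L$ whose least element $0_L$ is non-isolated, there is a maximal chain in $\langle\mathbb P(\mathbb B_n)\cup\{\emptyset\},\subset\rangle$ isomorphic to $L$.
   Context: $\mathbb P(\mathbb X)$ is the set of subsets of the domain of $\mathbb X$ whose induced suborder is isomorphic to $\mathbb X$. A linear order is complete if it has a least element $0_L$, a greatest element and no gaps; $0_L$ is non-isolated if it has no immediate successor; $\mathbb R$-embeddable means embeddable into $\langle\mathbb R,<\rangle$.
   Formalization: The formal statement additionally assumes that L has more than one element: the one-point order meets all stated conditions, but every maximal chain contains both the empty set and B_n, so the claim fails for it. *)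

(* Defs.v *)
From mathcomp Require Import all_boot all_order all_algebra.
From mathcomp Require Import boolp classical_sets reals.

Set Implicit Arguments.
Unset Strict Implicit.
Unset Printing Implicit Defensive.

Import Order.TTheory.
Local Open Scope classical_set_scope.
Local Open Scope order_scope.

Definition isomorphic (T U : Type) (ltT : T -> T -> Prop) (ltU : U -> U -> Prop)
    : Prop :=
  exists2 f : T -> U, bijective f & forall x y, ltT x y <-> ltU (f x) (f y).

Definition induced (T : Type) (lt : T -> T -> Prop) (A : set T)
    : A -> A -> Prop :=
  fun x y => lt (val x) (val y).

Definition copies (T : Type) (lt : T -> T -> Prop) : set (set T) :=
  [set A | isomorphic (induced lt (A := A)) lt].

Section Chains.
Variable T : Type.

Definition chain_in (F C : set (set T)) : Prop :=
  C `<=` F /\ total_on C subset.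

Definition maximal_chain (F C : set (set T)) : Prop :=
  chain_in F C /\ forall D, chain_in F D -> C `<=` D -> D = C.

End Chains.

Section LinearOrders.
Variables (d : Order.disp_t) (L : orderType d).

Definition is_least (x : L) : Prop := forall y, x <= y.

Definition is_greatest (x : L) : Prop := forall y, y <= x.

Definition is_gap (A B : set L) : Prop :=
  [/\ A !=set0 /\ B !=set0,
      A `|` B = setT,
      (forall a b, A a -> B b -> a < b),
      ~ (exists2 a, A a & forall x, A x -> x <= a)
    & ~ (exists2 b, B b & forall x, B x -> b <= x)].

Definition complete_order : Prop :=
  [/\ exists x, is_least x,
      exists x, is_greatest x
    & forall A B, ~ is_gap A B].

Definition immediate_successor (x y : L) : Prop :=
  x < y /\ ~ (exists z, x < z < y).

(* Also holds of the unique point of a one-element order, which is isolated in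
   the topological sense. *)
Definition non_isolated (x : L) : Prop := ~ (exists y, immediate_successor x y).

Definition real_embeddable (R : realType) : Prop :=
  exists f : L -> R, forall x y, (x < y) = (f x < f y).

End LinearOrders.

Definition B (n : nat) : Type := ('I_n * rat)%type.

Definition B_lt (n : nat) (x y : B n) : Prop := x.1 = y.1 /\ x.2 < y.2.

(* Main.v *)
(** Call a point of L a jump if it has an immediate predecessor; L has countably
    many jumps. Between two points with no jump in between L is densely ordered,
    and a countable set T meets all such intervals. Place the points t of T in
    every component at the real position f t, where f embeds L into R, and each
    jump b at one position [pos b] of one component, and let A_x consist of the
    t < x in T and the jumps b <= x. This family is increasing and indexed by L,
    it grows by a single point at a jump, and it is continuous from the left at
    the other points. From the right, A_x can only miss the points at position
    f x with x in T; adding some of them gives a component a greatest element, so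
    nothing between A_x and the intersection of the A_y, y > x, is a copy.
    It remains to choose the positions of the jumps so that every component of
    every A_x with x > 0_L is countable, dense and without endpoints, hence
    isomorphic to Q by Cantor's theorem. If there are no jumps near 0_L, then T is
    dense near 0_L and the jumps are placed there, at points kept out of T.
    Otherwise a sequence of jumps decreases to 0_L, and it is spread densely over
    all components below f 0_L: every A_x contains a tail of it. *)

Require Import Defs.
From mathcomp Require Import all_boot all_order all_algebra.
From mathcomp Require Import boolp classical_sets reals.
From mathcomp Require Import cardinality.
From mathcomp Require Import lra.

Local Open Scope classical_set_scope.

Set Implicit Arguments.
Unset Strict Implicit.
Unset Printing Implicit Defensive.

Import Order.TTheory GRing.Theory Num.Theory.

(** * Cantor's theorem on countable dense orders *)

Section Cantor.
Local Open Scope order_scope.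

(** The order-theoretic half of Cantor's characterization of the rationals; countability is a
    separate hypothesis where it is needed. *)
Definition eta_like d (T : orderType d) (X : set T) : Prop :=
  [/\ X !=set0,
      forall x y, X x -> X y -> x < y -> exists2 z, X z & x < z < y,
      forall x, X x -> exists2 y, X y & x < y
    & forall x, X x -> exists2 y, X y & y < x].

Lemma countable_range (T : Type) (X : set T) :
  countable X -> X !=set0 -> exists e : nat -> T, range e = X.
Proof.
move=> /countable_injP[g ginj] [x0 Xx0].
have /choice[e eP] : forall n, exists x, X x /\ forall y, X y -> g y = n -> y = x.
  move=> n; have [[x [Xx gx]]|no] := pselect (exists x, X x /\ g x = n).
    by exists x; split=> // y Xy gy; apply: ginj; rewrite ?inE// gx gy.
  by exists x0; split=> // y Xy gy; case: no; exists y.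
exists e; apply/seteqP; split=> [x [n _ <-]|x Xx]; first by case: (eP n).
by exists (g x) => //; rewrite -((eP (g x)).2 x).
Qed.

Lemma seq_has_max d (T : orderType d) (s : seq T) :
  s = [::] \/ exists2 m, m \in s & {in s, forall x, x <= m}.
Proof.
elim: s => [|a s [->|[m ms mmax]]]; [by left| |]; right.
  by exists a; rewrite ?mem_head// => x; rewrite inE => /eqP->.
have [am|ma] := leP a m.
  by exists m; rewrite ?inE ?ms ?orbT// => x; rewrite inE => /predU1P[->|/mmax].
exists a; rewrite ?mem_head// => x; rewrite inE => /predU1P[->//|/mmax xm].
exact: le_trans xm (ltW ma).
Qed.

Lemma seq_has_min d (T : orderType d) (s : seq T) :
  s = [::] \/ exists2 m, m \in s & {in s, forall x, m <= x}.
Proof. exact: (@seq_has_max _ T^d s). Qed.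

(** [v] is picked between the maximum of [s1] and the minimum of [s2]. Depending on which lists are
    empty, this uses nonemptiness, absence of a minimum, absence of a maximum, or density. *)
Lemma eta_like_between d (T : orderType d) (X : set T) (s1 s2 : seq T) :
  eta_like X -> {in s1, forall x, X x} -> {in s2, forall x, X x} ->
  {in s1 & s2, forall x y, x < y} ->
  exists v, [/\ X v, {in s1, forall x, x < v} & {in s2, forall y, v < y}].
Proof.
move=> [[z Xz] Xd Xmax Xmin] X1 X2 s12.
have [->|[m1 m1s m1P]] := seq_has_max s1; have [->|[m2 m2s m2P]] := seq_has_min s2.
- by exists z.
- have [v Xv vm] := Xmin _ (X2 _ m2s).
  by exists v; split=> // y /m2P; exact: lt_le_trans.
- have [v Xv vm] := Xmax _ (X1 _ m1s).
  by exists v; split=> // y /m1P ym; exact: le_lt_trans ym vm.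
- have [v Xv /andP[mv vm]] := Xd _ _ (X1 _ m1s) (X2 _ m2s) (s12 _ _ m1s m2s).
  exists v; split=> // y; first by move=> /m1P ym; exact: le_lt_trans ym mv.
  by move=> /m2P; exact: lt_le_trans.
Qed.

(** A finite partial isomorphism, stored as its graph. In linear orders the equality of strict
    comparisons already makes it functional and injective. *)
Definition matching d1 d2 (U : orderType d1) (V : orderType d2) (X : set U) (Y : set V)
    (l : seq (U * V)) : Prop :=
  {in l, forall p, X p.1 /\ Y p.2} /\
  {in l &, forall p q, (p.1 < q.1) = (p.2 < q.2)}.

Lemma matching_swap d1 d2 (U : orderType d1) (V : orderType d2) (X : set U)
    (Y : set V) (l : seq (U * V)) :
  matching X Y l -> matching Y X [seq (p.2, p.1) | p <- l].
Proof.
move=> [lXY lmono]; split=> [_ /mapP[p pl ->]|_ _ /mapP[p pl ->] /mapP[q ql ->]] /=.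
  by have [] := lXY p pl.
by rewrite lmono.
Qed.

Lemma matching_forth d1 d2 (U : orderType d1) (V : orderType d2) (X : set U)
    (Y : set V) (l : seq (U * V)) (u : U) :
  eta_like Y -> matching X Y l -> X u -> exists v, matching X Y ((u, v) :: l).
Proof.
move=> Yeta [lXY lmono] Xu.
have [[p pl pu]|new] := pselect (exists2 p, p \in l & p.1 = u).
  exists p.2; rewrite -pu -surjective_pairing.
  have sub q : (q \in p :: l) -> q \in l by rewrite inE => /predU1P[->|].
  by split=> [q /sub|q r /sub ql /sub rl]; [exact: lXY|exact: lmono].
(* A new [u] needs a partner above those of the smaller points and below those of the larger
   ones. *)
pose s1 := [seq p.2 | p <- l & p.1 < u]; pose s2 := [seq p.2 | p <- l & u < p.1].
have [||||v [Yv s1v vs2]] := @eta_like_between _ _ Y s1 s2 => //.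
- by move=> _ /mapP[p + ->]; rewrite mem_filter => /andP[_ /lXY[]].
- by move=> _ /mapP[p + ->]; rewrite mem_filter => /andP[_ /lXY[]].
- move=> _ _ /mapP[p + ->] /mapP[q + ->]; rewrite !mem_filter.
  move=> /andP[pu pl] /andP[uq ql]; rewrite -lmono//; exact: lt_trans uq.
have side p : p \in l -> p.1 < u /\ p.2 < v \/ u < p.1 /\ v < p.2.
  move=> pl; have [pu|up|eq_pu] := ltgtP p.1 u; last by case: new; exists p.
  - by left; split=> //; apply: s1v; apply/mapP; exists p; rewrite ?mem_filter ?pu.
  - by right; split=> //; apply: vs2; apply/mapP; exists p; rewrite ?mem_filter ?up.
exists v; split=> [p|p q]; first by rewrite inE => /predU1P[->//|/lXY].
rewrite !inE => /predU1P[->|pl] /predU1P[->|ql] /=; rewrite ?ltxx ?lmono//.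
- by have [[a b]|[a b]] := side q ql; rewrite ?a ?b ?(lt_gtF a) ?(lt_gtF b).
- by have [[a b]|[a b]] := side p pl; rewrite ?a ?b ?(lt_gtF a) ?(lt_gtF b).
Qed.

Lemma matching_back d1 d2 (U : orderType d1) (V : orderType d2) (X : set U)
    (Y : set V) (l : seq (U * V)) (v : V) :
  eta_like X -> matching X Y l -> Y v -> exists u, matching X Y ((u, v) :: l).
Proof.
move=> Xeta /matching_swap lYX Yv.
have [u /matching_swap /=] := matching_forth Xeta lYX Yv.
by rewrite -map_comp map_id_in => [m|[]//]; exists u.
Qed.

Lemma eta_like_rat : eta_like [set: rat].
Proof.
split=> [|x y _ _ xy|x _|x _]; first by exists 0%R.
- by exists ((x + y) / 2)%R => //; apply/andP; split; lra.
- by exists (x + 1)%R => //; lra.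
- by exists (x - 1)%R => //; lra.
Qed.

(** Back and forth: step [k] puts [r k] into the domain and [e k] into the range, and the union [G]
    of all steps is the graph of [h]. *)
Lemma eta_like_iso_rat d (V : orderType d) (Y : set V) :
  countable Y -> eta_like Y ->
  exists h : rat -> V, {mono h : p q / p < q} /\ range h = Y.
Proof.
move=> Yc Yeta; have [Y0 _ _ _] := Yeta.
have [e eY] := countable_range Yc Y0.
have [r rT] : exists r : nat -> rat, range r = setT :=
  countable_range (countableP [set: rat]) (ex_intro _ 0%R Logic.I).
have Ye k : Y (e k) by rewrite -eY; exists k.
pose st := {l : seq (rat * V) | matching [set: rat] Y l}.
have /choice[step stepP] : forall z : nat * st, exists l' : st,
    [/\ {subset sval z.2 <= sval l'}, exists v, (r z.1, v) \in sval l'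
      & exists u, (u, e z.1) \in sval l'].
  move=> [k [l lm]] /=.
  have [v m1] := matching_forth Yeta lm (Logic.I : [set: rat] (r k)).
  have [u m2] := matching_back eta_like_rat m1 (Ye k).
  exists (exist _ _ m2); split=> /=.
  - by move=> p pl; rewrite !inE pl !orbT.
  - by exists v; rewrite !inE eqxx orbT.
  - by exists u; rewrite inE eqxx.
have m0 : matching [set: rat] Y [::] by [].
pose L := fix L k : st := if k is k'.+1 then step (k', L k') else exist _ [::] m0.
have Lsub j k : (j <= k)%N -> {subset sval (L j) <= sval (L k)}.
  move=> jk; rewrite -(subnK jk); elim: (k - j)%N => [//|i IH] p /IH.
  rewrite addSn /=; have [+ _ _] := stepP ((i + j)%N, L (i + j)%N); exact.
pose G p := exists k, p \in sval (L k).
have Gmono p q : G p -> G q -> (p.1 < q.1) = (p.2 < q.2).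
  move=> [j pj] [k qk]; have [_ Lm] := svalP (L (maxn j k)).
  by apply: Lm; [apply: Lsub pj; exact: leq_maxl|apply: Lsub qk; exact: leq_maxr].
have /choice[h hG] : forall q, exists v, G (q, v).
  move=> q; have : range r q by rewrite rT.
  move=> [k _ <-]; have [_ [v vL] _] := stepP (k, L k).
  by exists v; exists k.+1.
have hmono : {mono h : p q / p < q}.
  by move=> p q; have := Gmono _ _ (hG p) (hG q).
exists h; split=> //; apply/seteqP; split=> [_ [q _ <-]|].
  by have [k qk] := hG q; have [Lm _] := svalP (L k); have [] := Lm _ qk.
(* Surjectivity: [h u] and [e k] are both partners of [u] in [G], so neither is below the other. *)
rewrite -eY => _ [k _ <-]; have [_ _ [u uL]] := stepP (k, L k).
have Gu : G (u, e k) by exists k.+1.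
exists u => //; have /= := Gmono _ _ (hG u) Gu; have /= := Gmono _ _ Gu (hG u).
by rewrite ltxx; case: ltgtP.
Qed.

End Cantor.

(** * Copies of B_n and maximal chains *)

Section Copies.
Local Open Scope order_scope.

(** Distinct components are incomparable, so the isomorphisms that Cantor's theorem gives in each
    component can be glued. *)
Lemma copy_of_eta_like n (X : set (B n)) :
  (forall i, eta_like [set q | X (i, q)]) -> copies (@B_lt n) X.
Proof.
move=> Xeta.
have /choice[h hP] : forall i, exists h : rat -> rat,
    {mono h : p q / p < q} /\ range h = [set q | X (i, q)].
  by move=> i; apply: eta_like_iso_rat (Xeta i); exact: countableP.
have hX p : (p.1, h p.1 p.2) \in X.
  by rewrite inE; have [_ /seteqP[+ _]] := hP p.1; apply; exists p.2.
pose g p : X := exist _ (p.1, h p.1 p.2) (hX p).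
have /choice[f fP] : forall x : X, exists p, g p = x.
  move=> [[i q] xX]; have [_ /seteqP[_ /(_ q)]] := hP i.
  by case=> [|p _ hpq]; [exact: set_mem|exists (i, p); apply: val_inj; rewrite /= hpq].
have ginj : injective g.
  move=> [i p] [j q] /(congr1 val)[]; case: _ / => hpq.
  by congr (_, _); apply: inc_inj hpq; apply: le_mono => ? ?; rewrite (hP i).1.
exists f; first by exists g => // p; apply: ginj.
move=> x y; rewrite -{1}(fP x) -{1}(fP y) /B_lt /induced /=; split=> -[eq_i].
  by rewrite eq_i (hP _).1.
by rewrite -eq_i (hP _).1.
Qed.

(** Raise the image of the point by 1 in its component and pull back. Maximality of the chain uses
    no other property of copies. *)
Lemma copy_no_max n (X : set (B n)) i q :
  copies (@B_lt n) X -> X (i, q) -> exists2 r, X (i, r) & q < r.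
Proof.
move=> [f [g fK gK] fmono] /mem_set Xq.
pose x : X := exist _ (i, q) Xq.
pose y := g ((f x).1, (f x).2 + 1)%R.
have [] : B_lt (val x) (val y).
  by apply/fmono; rewrite /y gK; split=> //=; rewrite ltrDl.
case: y => [[j r] Xr] /= -> qr; exists r => //; exact: set_mem.
Qed.

Section MaximalChain.
Variables (d : Order.disp_t) (L : orderType d) (T : Type).
Variables (F : set (set T)) (A : L -> set T).

(** A further member [X] of a larger chain would cut [L] into [lo] and [up]. As there are no gaps,
    [lo] has a maximum or [up] a minimum, and the local hypothesis at that point forces [X] into the
    family. *)
Lemma maximal_chain_of_family :
  complete_order L ->
  (forall x, F (A x)) ->
  {homo A : x y / x < y >-> x `<` y} ->
  (forall x, is_least x -> A x = set0) ->
  (forall x, is_greatest x -> A x = setT) ->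
  (forall a b p q, immediate_successor a b ->
     A b p -> ~ A a p -> A b q -> ~ A a q -> p = q) ->
  (forall b, ~ is_least b -> ~ (exists a, immediate_successor a b) ->
     A b `<=` \bigcup_(x in [set x | x < b]) A x) ->
  (forall a X, ~ is_greatest a -> ~ (exists b, immediate_successor a b) ->
     F X -> A a `<=` X -> X `<=` \bigcap_(y in [set y | a < y]) A y -> X = A a) ->
  exists2 C : set (set T), maximal_chain F C
    & isomorphic (induced (fun X Y : set T => X `<` Y) (A := C))
        (fun x y : L => x < y).
Proof.
move=> [[x0 x0P] [x1 x1P] nogap] FA Alt A0 A1 jump left_lim right_lim.
have Ale x y : x <= y -> A x `<=` A y.
  by rewrite le_eqVlt => /predU1P[->//|/Alt/properW].
have Altw x y : A x `<` A y -> x < y.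
  by move=> [_ nyx]; rewrite ltNge; apply/negP => /Ale.
exists (range A).
  split; first split.
  - by move=> _ [x _ <-].
  - move=> _ _ [x _ <-] [y _ <-].
    by have [/Ale|/ltW/Ale] := leP x y; [left|right].
  move=> D [DF Dtot] CD; apply/seteqP; split=> // X DX.
  apply: contrapT => XC.
  have XA x : X <> A x by move=> XAx; apply: XC; exists x.
  have cmp x : A x `<=` X \/ X `<=` A x by apply: Dtot => //; apply: CD; exists x.
  pose lo := [set x | A x `<=` X]; pose up := [set x | X `<=` A x].
  have lo_up a b : lo a -> up b -> a < b.
    move=> la ub; rewrite ltNge; apply/negP => ba; apply: (XA a).
    by apply/seteqP; split=> //; exact: subset_trans (Ale _ _ ba).
  have lo0 : lo x0 by rewrite /lo /= A0//; exact: sub0set.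
  have up1 : up x1 by rewrite /up /= A1.
  have upNlo x : ~ lo x -> up x by case: (cmp x).
  have loNup x : ~ up x -> lo x by case: (cmp x).
  have lt_up a x : (forall y, lo y -> y <= a) -> a < x -> up x.
    by move=> amax ax; apply: upNlo => /amax; rewrite leNgt ax.
  have [[a la amax]|nomax] := pselect (exists2 a, lo a & forall x, lo x -> x <= a).
    have na1 : ~ is_greatest a.
      by move=> /(_ x1); rewrite leNgt (lo_up _ _ la up1).
    have [[b ab]|nsucc] := pselect (exists b, immediate_successor a b).
      (* At a jump, [X] has a point outside [A a]; it is the only point that [A b] adds, so
         [X = A b]. *)
      have ub : up b by apply: (lt_up a) => //; exact: ab.1.
      have [p Xp nAp] : exists2 p, X p & ~ A a p.
        apply: contrapT => no; apply: (XA a); apply/seteqP; split=> // p Xp.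
        by apply: contrapT => nAp; apply: no; exists p.
      apply: (XA b); apply/seteqP; split=> // q Aq.
      have [/la//|nAq] := pselect (A a q).
      by rewrite -(jump a b p q ab (ub _ Xp) nAp Aq nAq).
    apply: (XA a); apply: right_lim => //; first exact: DF.
    by move=> p Xp y /= ay; apply: (lt_up a y amax ay).
  have [[b ub bmin]|nomin] := pselect (exists2 b, up b & forall x, up x -> b <= x).
    have lt_lo x : x < b -> lo x by move=> xb; apply: loNup => /bmin; rewrite leNgt xb.
    apply: (XA b); apply/seteqP; split=> // p.
    move=> /(left_lim b) []; last by move=> x /lt_lo; apply.
      by move=> /(_ x0); rewrite leNgt (lo_up _ _ lo0 ub).
    (* An immediate predecessor of [b] would be the maximum of [lo]. *)
    move=> [a [ab nab]]; apply: nomax; exists a; first exact: lt_lo.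
    move=> x lx; rewrite leNgt; apply/negP => ax; apply: nab; exists x.
    by rewrite ax lo_up.
  apply: (nogap lo up); split=> //; first by split; [exists x0|exists x1].
  by apply/seteqP; split=> // x _; exact: cmp.
have Amem x : A x \in range A by rewrite inE; exists x.
pose g x : range A := exist _ (A x) (Amem x).
have /choice[f fP] : forall c : range A, exists x, g x = c.
  move=> [c cA]; have [x _ xc] := set_mem cA.
  by exists x; apply: val_inj.
have ginj : injective g.
  move=> x y /(congr1 val) /= Axy.
  have [/Alt|/Alt|//] := ltgtP x y; by rewrite Axy => /properxx.
exists f; first by exists g => // x; apply: ginj.
move=> x y; rewrite -{1}(fP x) -{1}(fP y) /induced /=.
by split; [exact: Altw|exact: Alt].
Qed.

End MaximalChain.
End Copies.

(** * Chains given by labels *)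

Section JumpFree.
Local Open Scope order_scope.
Variables (d : Order.disp_t) (L : orderType d).
Implicit Types (a b u v s t x y : L).

Definition has_pred b : Prop := exists a, immediate_successor a b.

(** The half-open interval ]u, v] contains no jump. Including [v] rules out that [v] is the
    immediate successor of [u]. *)
Definition jump_free u v : Prop := forall b, has_pred b -> u < b -> v < b.

(** Imposed on the points of [T]: such a point has no immediate successor, and a set that is dense
    in jump-free intervals accumulates at it from the right. *)
Definition locally_jump_free s : Prop :=
  exists u v, [/\ u < s, s < v & jump_free u v].

Lemma jump_free_sub u v u' v' :
  u <= u' -> v' <= v -> jump_free u v -> jump_free u' v'.
Proof.
move=> uu' v'v uv b jb u'b; apply: le_lt_trans v'v _.
exact: uv jb (le_lt_trans uu' u'b).
Qed.

Lemma jump_free_dense u v : jump_free u v -> u < v -> exists z, u < z < v.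
Proof.
move=> juv uv; apply: contrapT => no.
by have := juv v (ex_intro _ u (conj uv no)) uv; rewrite ltxx.
Qed.

Lemma jump_freeN u v : ~ jump_free u v -> exists2 b, has_pred b & u < b <= v.
Proof.
move=> nj; apply: contrapT => no; apply: nj => b jb ub.
by rewrite ltNge; apply/negP => bv; apply: no; exists b; rewrite ?ub.
Qed.

Definition dense_in_jump_free (T : set L) : Prop :=
  forall a b, jump_free a b -> a < b -> exists2 t, T t & a < t < b.

Lemma dense_right (T : set L) s x : dense_in_jump_free T ->
  locally_jump_free s -> s < x -> exists2 t, T t & s < t < x.
Proof.
move=> Td [u [v [us sv juv]]] sx.
have [||t Tt /andP[st]] := Td s (Order.min x v).
- by apply: jump_free_sub juv; [exact: ltW|rewrite ge_min lexx orbT].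
- by rewrite lt_min sx.
- by rewrite lt_min => /andP[tx _]; exists t; rewrite ?st.
Qed.

Lemma dense_left (T : set L) s : dense_in_jump_free T ->
  locally_jump_free s -> exists2 t, T t & t < s.
Proof.
move=> Td [u [v [us sv juv]]].
have [|t Tt /andP[_ ts]] := Td u s _ us; last by exists t.
by apply: jump_free_sub juv; [exact: lexx|exact: ltW].
Qed.

Variable (R : realType) (f : L -> R).
Hypothesis f_lt : forall x y, (x < y) = (f x < f y).

Lemma embedding_inj : injective f.
Proof.
move=> x y fxy; apply/eqP; rewrite eq_le !leNgt !f_lt fxy.
by rewrite ltxx.
Qed.

(** The intervals between [f a] and [f b], for a jump [b] with immediate predecessor [a], are
    pairwise disjoint, and each contains a rational. *)
Lemma countable_has_pred : countable has_pred.
Proof.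
have /choice[g gP] : forall b, exists q : rat, has_pred b ->
    exists2 a, immediate_successor a b & (f a < ratr q < f b)%R.
  move=> b; have [[a ab]|no] := pselect (has_pred b); last by exists 0%R.
  have : (f a < f b)%R by rewrite -f_lt; exact: ab.1.
  by move=> /rat_in_itvoo[q]; rewrite in_itv /= => abq; exists q => _; exists a.
have gmono b c : has_pred b -> has_pred c -> b < c -> (g b < g c)%R.
  move=> /gP[_ _ /andP[_ gb]] /gP[a [ac nac] /andP[ga _]] bc.
  rewrite -(ltr_rat R); apply: lt_trans gb _; apply: le_lt_trans ga.
  rewrite leNgt -f_lt; apply/negP => ab; apply: nac; exists b.
  by rewrite ab.
apply/countable_injP; exists (fun b => pickle (g b)) => b c.
rewrite !inE => jb jc /(pcan_inj pickleK) gbc.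
by have [/(gmono _ _ jb jc)|/(gmono _ _ jc jb)|//] := ltgtP b c; rewrite gbc ltxx.
Qed.

(** For each rational interval that meets the image of [f], one point of [L] is selected there.
    Around [f z] such an interval fits between [f a] and [f b]. *)
Lemma countable_order_dense :
  exists2 E : set L, countable E
    & forall a z b, a < z < b -> exists2 e, E e & a < e < b.
Proof.
have [[x0 _]|empty] := pselect (exists x0 : L, True); last first.
  by exists set0 => // a; case: empty; exists a.
have /choice[g gP] : forall pq : rat * rat, exists e, forall z,
    (ratr pq.1 < f z < ratr pq.2)%R -> (ratr pq.1 < f e < ratr pq.2)%R.
  move=> pq; have [[z zP]|no] := pselect (exists z, ratr pq.1 < f z < ratr pq.2)%R.
    by exists z.
  by exists x0 => z zP; case: no; exists z.
exists (range g); first exact: sub_countable (card_image_le _ _) _.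
move=> a z b; rewrite !f_lt => /andP[/rat_in_itvoo[p] + /rat_in_itvoo[q]].
rewrite !in_itv /= => /andP[ap pz] /andP[zq qb].
have /andP[pe eq] := gP (p, q) z (introT andP (conj pz zq)).
exists (g (p, q)); first by exists (p, q).
rewrite !f_lt (lt_trans ap pe) /=.
exact: lt_trans eq qb.
Qed.

End JumpFree.

Lemma countable_setU (T : Type) (X Y : set T) :
  countable X -> countable Y -> countable (X `|` Y).
Proof.
move=> cX cY; rewrite (_ : X `|` Y = \bigcup_(b in [set: bool]) if b then X else Y).
  by apply: bigcup_countable => // -[].
apply/seteqP; split=> [x [Xx|Yx]|x [[] _ /=]]; try by [left|right].
  by exists true.
by exists false.
Qed.

Lemma eta_like_preimage d1 d2 (T : orderType d1) (U : orderType d2) (h : T -> U)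
    (X : set U) :
  {mono h : p q / (p < q)%O} -> X `<=` range h -> eta_like X ->
  eta_like (h @^-1` X).
Proof.
move=> hm Xh [[x Xx] Xd Xmax Xmin]; split.
- by have [p _ hp] := Xh _ Xx; exists p; rewrite /= hp.
- move=> p q Xp Xq; rewrite -hm => pq; have [z Xz] := Xd _ _ Xp Xq pq.
  by have [r _ hr] := Xh _ Xz; rewrite -hr !hm => prq; exists r; rewrite //= hr.
- move=> p /Xmax[z Xz]; have [r _ hr] := Xh _ Xz.
  by rewrite -hr hm => pr; exists r; rewrite //= hr.
- move=> p /Xmin[z Xz]; have [r _ hr] := Xh _ Xz.
  by rewrite -hr hm => pr; exists r; rewrite //= hr.
Qed.

(** * The chain of stages in real positions *)

Section Labelled.
Local Open Scope order_scope.
Variables (R : realType) (n : nat) (d : Order.disp_t) (L : orderType d).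
Variables (f : L -> R) (T : set L) (pos : L -> 'I_n * R).

(** The strict bound on [t] gives continuity from the left at points of [T]; the weak bound on [b]
    makes a jump contribute its own position at once. *)
Definition stage (x : L) (i : 'I_n) : set R :=
  [set r | (exists2 t, T t & t < x /\ f t = r) \/
           (exists2 b, has_pred b & b <= x /\ pos b = (i, r))].

Lemma stage_chain :
  (0 < n)%N -> complete_order L ->
  (forall x y, (x < y) = (f x < f y)%R) ->
  countable T -> (forall t, T t -> locally_jump_free t) -> dense_in_jump_free T ->
  (forall b c, has_pred b -> has_pred c -> pos b = pos c -> b = c) ->
  (forall b t, has_pred b -> T t -> (pos b).2 <> f t) ->
  (forall b t, has_pred b -> T t -> b <= t -> ((pos b).2 < f t)%R) ->
  (forall x i, ~ is_least x -> eta_like (stage x i)) ->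
  (exists x : L, ~ is_least x) ->
  exists2 C : set (set (B n)),
    maximal_chain (copies (@B_lt n) `|` [set set0]) C
    & isomorphic (induced (fun X Y : set (B n) => X `<` Y) (A := C))
        (fun x y : L => x < y).
Proof.
move=> n0 Lc f_lt Tc Tljf Td pos_inj posT pos_lt Deta nontriv.
have f_inj := embedding_inj f_lt.
have stageT x i t : T t -> stage x i (f t) -> t < x.
  move=> Tt [[t' _ [t'x /f_inj <-//]]|[b jb [bx pb]]].
  by case: (posT b t jb Tt); rewrite pb.
have stageJ x i b r : has_pred b -> pos b = (i, r) -> stage x i r -> b <= x.
  move=> jb pb [[t Tt [tx ft]]|[c jc [cx pc]]].
    by case: (posT b t jb Tt); rewrite pb.
  by rewrite (pos_inj b c)// pb pc.
have stage_le x y i : x <= y -> stage x i `<=` stage y i.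
  move=> xy r [[t Tt [tx ft]]|[b jb [bx pb]]]; [left|right].
    by exists t => //; split=> //; exact: lt_le_trans xy.
  by exists b => //; split=> //; exact: le_trans xy.
have [_ [top topP] _] := Lc.
have ntop : ~ is_least top.
  by move=> ltop; have [x nx] := nontriv; apply: nx => y; exact: le_trans (ltop y).
(* The last stage contains all others, so identifying it with the rationals turns every stage into a
   subset of [B n]. *)
have /choice[h hP] : forall i, exists h : rat -> R,
    {mono h : p q / (p < q)%O} /\ range h = stage top i.
  move=> i; apply: eta_like_iso_rat; last exact: Deta.
  pose Y := (f @` T) `|` ((fun b => (pos b).2) @` @has_pred _ L).
  apply: (@sub_countable _ _ _ Y); last first.
    apply: countable_setU; apply: sub_countable (card_image_le _ _) _ => //.
    exact: countable_has_pred f_lt.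
  apply: subset_card_le => r [[t Tt [_ <-]]|[b jb [_ pb]]]; first by left; exists t.
  by right; exists b => //; rewrite pb.
have stage_h x i r : stage x i r -> exists q, h i q = r.
  move=> /(stage_le _ top i (topP x)); rewrite -(hP i).2 => -[q _ <-].
  by exists q.
pose A x : set (B n) := [set p | stage x p.1 (h p.1 p.2)].
have A_le x y : x <= y -> A x `<=` A y by move=> xy p; exact: stage_le.
have A_inj p q : p.1 = q.1 -> h p.1 p.2 = h q.1 q.2 -> p = q :> B n.
  case: p q => [i p] [j q] /= <- hpq; congr (_, _).
  by apply: inc_inj hpq; apply: le_mono => ? ?; rewrite (hP i).1.
apply: (@maximal_chain_of_family _ _ _ _ A) => //.
- move=> x; have [lx|nlx] := pselect (is_least x).
    right; apply/seteqP; split=> // p [[t _ [tx _]]|[b [a [ab _]] [bx _]]].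
      by have := lx t; rewrite leNgt tx.
    by have := lx a; rewrite leNgt (lt_le_trans ab bx).
  left; apply: copy_of_eta_like => i.
  apply: (@eta_like_preimage _ _ _ _ (h i) (stage x i)).
  + exact: (hP i).1.
  + by rewrite (hP i).2; exact: stage_le.
  + exact: Deta.
- move=> x y xy; split; first exact/A_le/ltW.
  (* Growth is strict: ]x, y] either is jump-free, and then a point of [T] lies inside, or contains
     a jump, whose position is new. *)
  have [jxy|/jump_freeN[b jb /andP[xb bY]]] := pselect (jump_free x y).
    have [t Tt /andP[xt ty]] := Td x y jxy xy.
    have ft : stage y (Ordinal n0) (f t) by left; exists t.
    have [q hq] := stage_h _ _ _ ft.
    move=> /(_ (Ordinal n0, q)); rewrite /A /= hq => /(_ ft) /(stageT _ _ _ Tt).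
    by rewrite ltNge (ltW xt).
  case pb : (pos b) => [i r].
  have br : stage y i r by right; exists b.
  have [q hq] := stage_h _ _ _ br.
  move=> /(_ (i, q)); rewrite /A /= hq => /(_ br) /(stageJ _ _ _ _ jb pb).
  by rewrite leNgt xb.
- move=> x lx; apply/seteqP; split=> // p [[t _ [tx _]]|[b [a [ab _]] [bx _]]].
    by have := lx t; rewrite leNgt tx.
  by have := lx a; rewrite leNgt (lt_le_trans ab bx).
- move=> x gx; have -> : x = top by apply/eqP; rewrite eq_le topP gx.
  apply/seteqP; split=> // -[i q] _; rewrite /A /= -(hP i).2.
  by exists q.
- move=> a b p q ab.
  have new p' : A b p' -> ~ A a p' -> pos b = (p'.1, h p'.1 p'.2).
    move=> [[t Tt [tb ft]]|[c jc [cb pc]]] nA.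
      exfalso; have [ta|at_|ta] := ltgtP t a.
      + by apply: nA; left; exists t.
      + by apply: ab.2; exists t; rewrite at_.
      (* [t = a] is impossible: the immediate successor [b] of [a] is a jump, while [t] has a
         jump-free neighbourhood. *)
      + have [u [v [ut tv juv]]] := Tljf t Tt; apply: ab.2; exists v.
        rewrite -ta tv /=; apply: juv; first by exists a.
        by apply: lt_trans ut _; rewrite ta; exact: ab.1.
    have [cb'|//|<-//] := ltgtP c b; last by rewrite ltNge cb.
    exfalso; apply: nA; right; exists c => //; split=> //.
    by rewrite leNgt; apply/negP => ac; apply: ab.2; exists c; rewrite ac.
  by move=> /new Ap /Ap {}Ap /new Aq /Aq; rewrite Ap => -[]; exact: A_inj.
- move=> b nl np p [[t Tt [tb ft]]|[c jc [cb pc]]].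
    have [z /andP[tz zb]] : exists z, t < z < b.
      by apply: contrapT => no; apply: np; exists t.
    by exists z => //; left; exists t.
  exists c => /=; last by right; exists c.
  by rewrite lt_neqAle cb andbT; apply/eqP => cb'; apply: np; rewrite -cb'.
- move=> a X ng ns FX AX XA; apply/seteqP; split=> // -[i q] Xq.
  apply: contrapT => nA.
  have [y ay] : exists y, a < y.
    apply: contrapT => no; apply: ng => y; rewrite leNgt; apply/negP => ay.
    by apply: no; exists y.
  have right_le r j b : has_pred b -> pos b = (j, h j r) -> X (j, r) -> b <= a.
    move=> jb pb Xr; rewrite leNgt; apply/negP => ab; apply: ns; exists b.
    split=> // -[z /andP[az zb]].
    have /(stageJ _ _ _ _ jb pb) := XA _ Xr z az.
    by rewrite leNgt zb.
  have right_leT r j t : T t -> f t = h j r -> X (j, r) -> t <= a.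
    move=> Tt ft Xr; rewrite leNgt; apply/negP => a_t.
    by have := XA _ Xr t a_t; rewrite /A /= -ft => /(stageT _ _ _ Tt); rewrite ltxx.
  (* A point of [X] missing from [A a] must sit at [f a]. All of [X] in that component lies at or
     below [f a], by [pos_lt] for the jumps, so this point would be greatest there. *)
  have [Ta fa] : T a /\ f a = h i q.
    have [[t Tt [_ /= ft]]|[b jb [_ /= pb]]] := XA _ Xq y ay; last first.
      by case: nA; right; exists b => //; split=> //; exact: right_le pb Xq.
    have := right_leT _ _ _ Tt ft Xq; rewrite le_eqVlt => /predU1P[<-//|ta].
    by case: nA; left; exists t.
  have CX : copies (@B_lt n) X by case: FX => // X0; rewrite X0 in Xq.
  have [r Xr] := copy_no_max CX Xq.
  rewrite -(hP i).1 -fa; apply/negP; rewrite -leNgt.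
  have [[t Tt [_ /= ft]]|[b jb [_ /= pb]]] := XA _ Xr y ay.
    rewrite -ft leNgt -f_lt -leNgt; exact: right_leT ft Xr.
  have := pos_lt b a jb Ta (right_le _ _ _ jb pb Xr).
  by rewrite pb /=; exact: ltW.
Qed.

End Labelled.

(** * Choice of the labels *)

Section Avoidance.
Local Open Scope order_scope.
Variables (d : Order.disp_t) (L : orderType d).

(** If a term lies in the interval, the space between it and the next term is free of terms. *)
Lemma decreasing_seq_avoid (w : nat -> L) (a b : L) :
  (forall k, w k.+1 < w k) -> a < b ->
  exists a' b', [/\ a <= a', a' < b', b' <= b & forall k, ~ (a' < w k < b')].
Proof.
move=> wdec ab; have wle := Order.NatMonotonyTheory.decnP wdec.
have [[k /andP[ak kb]]|no] := pselect (exists k, a < w k < b); last first.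
  by exists a, b; split=> // k kP; apply: no; exists k.
exists (Order.max a (w k.+1)), (w k); split.
- by rewrite le_max lexx.
- by rewrite gt_max ak wdec.
- exact: ltW.
- move=> j; rewrite gt_max => /andP[/andP[_ +] +].
  by rewrite !ltNge !wle !leEnat -!ltnNge ltnS => jk kj; have := leq_trans kj jk; rewrite ltnn.
Qed.

Lemma finite_avoid (s : seq L) (a b : L) :
  a < b -> exists b', [/\ a < b', b' <= b & forall x, x \in s -> ~ (a < x < b')].
Proof.
move=> ab; elim: s => [|x s [b' [ab' b'b sP]]]; first by exists b.
have [ax|xa] := ltP a x.
  exists (Order.min x b'); split; rewrite ?lt_min ?ax ?ge_min ?b'b ?orbT// => y.
  rewrite inE lt_min => /predU1P[->|/sP ys] /andP[ay /andP[yx yb]].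
    by rewrite ltxx in yx.
  by apply: ys; rewrite ay.
exists b'; split=> // y; rewrite inE => /predU1P[->|/sP//].
by rewrite ltNge xa.
Qed.

Lemma non_isolated_below (x0 x : L) :
  non_isolated x0 -> x0 < x -> exists2 z, x0 < z & z < x.
Proof.
move=> ni x0x; apply: contrapT => no; apply: ni; exists x; split=> // -[z /andP[? ?]].
by apply: no; exists z.
Qed.

End Avoidance.

(** Supplies seed positions below: [q] avoids the negative integers, and the lower bound on its code
    will make the associated jump small enough. *)
Lemma rat_avoid (R : realType) (n : nat) (i : 'I_n) (m : nat) (a b : R) :
  (a < b)%R -> exists q : rat, [/\ (a < ratr q < b)%R,
    forall k, q <> (- k.+1%:R)%R & (m <= pickle (i, q))%N].
Proof.
move=> /rat_in_itvoo[p]; rewrite in_itv /= => /andP[ap /rat_in_itvoo[p']].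
rewrite in_itv /= ltr_rat => /andP[pp' p'b].
pose w k : rat := (- k.+1%:R)%R.
have w_dec k : (w k.+1 < w k)%R by rewrite /w ltrN2 ltr_nat.
have [u [v [pu uv vp' wP]]] := decreasing_seq_avoid w_dec pp'.
pose code k : option rat := omap snd (unpickle k : option ('I_n * rat)).
(* Only finitely many rationals have a code below [m]. *)
have [v' [uv' v'v sP]] := finite_avoid (pmap code (iota 0 m)) uv.
exists ((u + v') / 2)%R; set q := ((u + v') / 2)%R.
have uq : (u < q)%R by rewrite /q; lra.
have qv' : (q < v')%R by rewrite /q; lra.
split.
- rewrite (lt_trans ap) ?ltr_rat ?(le_lt_trans pu uq)//= (lt_trans _ p'b)// ltr_rat.
  exact: lt_le_trans (lt_le_trans qv' v'v) vp'.
- by move=> k qk; apply: (wP k); rewrite /w -qk uq (lt_le_trans qv' v'v).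
- rewrite leqNgt; apply/negP => qm; apply: (sP q); last by rewrite uq.
  rewrite mem_pmap; apply/mapP; exists (pickle (i, q)); first by rewrite mem_iota.
  by rewrite /code pickleK.
Qed.

(** * The two ways of placing the jumps *)

Section Cases.
Local Open Scope order_scope.
Variables (R : realType) (n : nat) (d : Order.disp_t) (L : orderType d).
Variables (f : L -> R) (x0 : L).
Hypotheses (n0 : (0 < n)%N) (Lc : complete_order L).
Hypothesis f_lt : forall x y, (x < y) = (f x < f y)%R.
Hypotheses (x0_least : is_least x0) (x0_limit : non_isolated x0).
Hypothesis nontriv : exists x : L, ~ is_least x.

Let conclusion := exists2 C : set (set (B n)),
    maximal_chain (copies (@B_lt n) `|` [set set0]) C
    & isomorphic (induced (fun X Y : set (B n) => X `<` Y) (A := C))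
        (fun x y : L => x < y).

Lemma not_least_gt x : ~ is_least x -> x0 < x.
Proof.
move=> nx; rewrite lt_neqAle x0_least andbT; apply/eqP => xx0.
by apply: nx; rewrite -xx0.
Qed.

Lemma has_pred_gt b : has_pred b -> x0 < b.
Proof. by move=> [a [ab _]]; apply: le_lt_trans (x0_least a) ab. Qed.

(* The jumps go to the points w k of ]x0, c[; they only show up after c, when the
   points of T below c are already there. *)
Lemma chain_initial_interval c : x0 < c -> jump_free x0 c -> conclusion.
Proof.
move=> x0c jc.
have [E Ec Ed] := countable_order_dense f_lt.
have [code code_inj] := elimT (countable_injP _) (countable_has_pred f_lt).
have /choice[next nextP] : forall z, exists y, x0 < z -> x0 < y < z.
  move=> z; have [x0z|no] := pselect (x0 < z); last by exists x0.
  by have [y x0y yz] := non_isolated_below x0_limit x0z; exists y; rewrite x0y.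
(* The shift by one makes [w 0] strictly smaller than [c]. *)
pose w k := iter k.+1 next c.
have w_gt k : x0 < iter k next c.
  by elim: k => //= k IH; have /andP[] := nextP _ IH.
have w_dec k : iter k.+1 next c < iter k next c by have /andP[] := nextP _ (w_gt k).
have w_mono := Order.NatMonotonyTheory.decnP (fun k => w_dec k.+1).
have w_lt k : w k < c.
  by elim: k => [|k IH]; [exact: w_dec 0%N|apply: lt_trans IH; exact: w_dec].
have w_inj : injective w := dec_inj w_mono.
(* Removing the terms of [w] keeps positions of jumps apart from [T]; density survives since [w] is
   decreasing. *)
pose T := [set t | [/\ E t, locally_jump_free t & forall k, w k <> t]].
have Td : dense_in_jump_free T.
  move=> a b jab ab.
  have [a' [b' [aa' a'b' b'b wP]]] :=
    decreasing_seq_avoid (fun k => w_dec k.+1) ab.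
  have ja'b' : jump_free a' b' by exact: jump_free_sub jab.
  have [z /Ed[e Ee /andP[a'e eb']]] := jump_free_dense ja'b' a'b'.
  exists e; last by rewrite (le_lt_trans aa' a'e) (lt_le_trans eb' b'b).
  split=> //; first by exists a', b'.
  by move=> k wk; apply: (wP k); rewrite -/(w k) wk a'e.
have w_ljf k : locally_jump_free (w k) by exists x0, c; split=> //; exact: w_gt.
have f_inj := embedding_inj f_lt.
pose pos b : 'I_n * R := (Ordinal n0, f (w (code b))).
have w_lt_pred k b x : has_pred b -> b <= x -> w k < x.
  move=> jb bx; apply: lt_le_trans bx; apply: lt_trans (w_lt k) _.
  exact: jc (has_pred_gt jb).
apply: (@stage_chain R n d L f T pos) => //.
- by apply: sub_countable Ec; apply: subset_card_le => t [].
- by move=> t [].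
- move=> b b' jb jb' [/f_inj/w_inj]; apply: code_inj; exact: mem_set.
- by move=> b t jb [_ _ wt] /f_inj /wt.
- by move=> b t jb [_ _ _] bt; rewrite -f_lt; exact: w_lt_pred bt.
move=> x i /not_least_gt x0x.
have in_stage t : T t -> t < x -> stage f T pos x i (f t) by left; exists t.
(* Jumps too are placed at locally jump-free points below [x], so density of [T] provides all the
   neighbours required. *)
have stage_in r : stage f T pos x i r ->
    exists s, [/\ r = f s, locally_jump_free s & s < x].
  move=> [[t [_ tl _] [tx <-]]|[b jb [bx [_ <-]]]]; first by exists t.
  by exists (w (code b)); split=> //; exact: w_lt_pred bx.
split.
- have [||t Tt] := Td x0 (Order.min x c).
  + by apply: jump_free_sub jc; rewrite ?lexx// ge_min lexx orbT.
  + by rewrite lt_min x0x.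
  + by rewrite lt_min => /andP[_ /andP[tx _]]; exists (f t); exact: in_stage.
- move=> _ _ /stage_in[s [-> sl sx]] /stage_in[s' [-> _ s'x]]; rewrite -f_lt => ss'.
  have [t Tt /andP[st ts']] := dense_right Td sl ss'.
  exists (f t); first by apply: in_stage => //; exact: lt_trans s'x.
  by rewrite -!f_lt st.
- move=> _ /stage_in[s [-> sl sx]].
  have [t Tt /andP[st tx]] := dense_right Td sl sx.
  by exists (f t); [exact: in_stage|rewrite -f_lt].
- move=> _ /stage_in[s [-> sl sx]].
  have [t Tt ts] := dense_left Td sl.
  by exists (f t); [apply: in_stage => //; exact: lt_trans sx|rewrite -f_lt].
Qed.

(** All jumps are placed below [f x0] and all of [T] lies above it. The seeds fill the lower part
    densely in every component, and [T] takes care of the upper part. *)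
Lemma chain_accumulating_jumps :
  (forall c, x0 < c -> ~ jump_free x0 c) -> conclusion.
Proof.
move=> nj.
have [E Ec Ed] := countable_order_dense f_lt.
have [code code_inj] := elimT (countable_injP _) (countable_has_pred f_lt).
have pred_below x : x0 < x -> exists2 b, has_pred b & b < x.
  move=> /(non_isolated_below x0_limit)[z x0z zx].
  have [b jb /andP[_ bz]] := jump_freeN (nj z x0z).
  by exists b => //; exact: le_lt_trans zx.
have [b0 jb0] : exists b : L, has_pred b.
  by have [x /not_least_gt/pred_below[b jb _]] := nontriv; exists b.
have [e eJ] := countable_range (countable_has_pred f_lt) (ex_intro _ b0 jb0).
(* Going below [e k] at step [k] brings the sequence under every jump, hence under every point above
   [x0]. *)
have /choice[next nextP] : forall zk : L * nat, exists b, has_pred zk.1 ->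
    [/\ has_pred b, b < zk.1 & b < e zk.2].
  move=> [z k] /=; have [jz|no] := pselect (has_pred z); last by exists z.
  have je : has_pred (e k) by rewrite -eJ; exists k.
  have [|b jb] := pred_below (Order.min z (e k)).
    by rewrite lt_min !has_pred_gt.
  by rewrite lt_min => /andP[bz be]; exists b.
pose c := fix c k := if k is k'.+1 then next (c k', k') else b0.
have c_pred k : has_pred (c k).
  by elim: k => [//|k IH] /=; have [] := nextP (c k, k) IH.
have c_dec k : c k.+1 < c k by have [] := nextP (c k, k) (c_pred k).
have c_mono := Order.NatMonotonyTheory.decnP c_dec.
have c_inj : injective c := dec_inj c_mono.
have c_coinitial x : x0 < x -> exists m, forall k, (m <= k)%N -> c k <= x.
  move=> /pred_below[b + bx]; rewrite -eJ => -[m _ em].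
  exists m.+1 => k mk; apply: le_trans (ltW bx); rewrite -em.
  have [_ _ /ltW] := nextP (c m, m) (c_pred m); apply: le_trans.
  by rewrite -/(c m.+1) c_mono leEnat.
(* The seeds get all negative rational offsets except the negative integers, which
   are reserved for the remaining jumps. *)
pose seed b (p : 'I_n * R) := exists (i : 'I_n) (q : rat), [/\ b = c (pickle (i, q)), (q < 0)%R,
  forall k, q <> (- k.+1%:R)%R & p = (i, f x0 + ratr q)%R].
(* The successor keeps the offset negative even when [code b] is 0. *)
have /choice[pos posP] : forall b, exists p, seed b p \/
    (forall p', ~ seed b p') /\ p = (Ordinal n0, f x0 + ratr (- (code b).+1%:R))%R.
  move=> b; have [[p bp]|no] := pselect (exists p, seed b p); first by exists p; left.
  exists (Ordinal n0, f x0 + ratr (- (code b).+1%:R))%R; right; split=> // p bp.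
  by apply: no; exists p.
have pos_seed (i : 'I_n) (q : rat) : (q < 0)%R -> (forall k, q <> (- k.+1%:R)%R) ->
    pos (c (pickle (i, q))) = (i, f x0 + ratr q)%R.
  move=> q0 qk; case: (posP (c (pickle (i, q)))).
    by move=> [j [r [/c_inj/(pcan_inj pickleK)[<- <-] _ _ ->]]].
  by case=> /(_ (i, f x0 + ratr q)%R) []; exists i, q.
have pos_neg b : ((pos b).2 < f x0)%R.
  have [[i [q [_ q0 _ ->]]]|[_ ->]] /= := posP b; first by rewrite gtrDl ltrq0.
  by rewrite gtrDl ltrq0 oppr_lt0 ltr0n.
have f_inj := embedding_inj f_lt.
have addr_ratr_inj (q r : rat) : (f x0 + ratr q = f x0 + ratr r -> q = r)%R.
  by move=> /addrI /eqP; rewrite (inj_eq (fmorph_inj _)) => /eqP.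
pose T := [set t | E t /\ locally_jump_free t].
have T_gt t : T t -> (f x0 < f t)%R.
  by move=> [_ [u [v [ut _ _]]]]; rewrite -f_lt; exact: le_lt_trans (x0_least u) ut.
have Td : dense_in_jump_free T.
  move=> a b jab ab; have [z /Ed[t Et /andP[at_ tb]]] := jump_free_dense jab ab.
  by exists t; [split=> //; exists a, b|rewrite at_].
apply: (@stage_chain R n d L f T pos) => //.
- by apply: sub_countable Ec; apply: subset_card_le => t [].
- by move=> t [].
- move=> b b' jb jb'.
  have [[i [q [-> q0 qk ->]]]|[_ ->]] := posP b;
  have [[i' [q' [-> q'0 q'k ->]]]|[_ ->]] := posP b'.
  + by move=> [<- /addr_ratr_inj <-].
  + by move=> [_ /addr_ratr_inj /qk].
  + by move=> [_ /addr_ratr_inj /esym /q'k].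
  + move=> [/addr_ratr_inj /oppr_inj /eqP]; rewrite eqr_nat eqSS => /eqP.
    by apply: code_inj; exact: mem_set.
- by move=> b t _ /T_gt + pt; rewrite -pt => /(lt_trans (pos_neg b)); rewrite ltxx.
- by move=> b t _ /T_gt + _; exact: lt_trans.
move=> x i /not_least_gt x0x.
(* A seed with index at least [m] is at most [x], so discarding finitely many seeds leaves a dense
   set of positions. *)
have seeds a b : (a < b)%R -> (b <= f x0)%R ->
    exists2 r, stage f T pos x i r & (a < r < b)%R.
  move=> ab bx0; have [m mP] := c_coinitial x x0x.
  have [|q [/andP[aq qb] qk mq]] := @rat_avoid R n i m (a - f x0)%R (b - f x0)%R.
    by rewrite ltrD2r.
  have q0 : (q < 0)%R.
    by rewrite -(ltrq0 R); apply: lt_le_trans qb _; rewrite subr_le0.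
  exists (f x0 + ratr q)%R; last by rewrite -ltrBlDl aq -ltrBrDl qb.
  by right; exists (c (pickle (i, q))) => //; split; [exact: mP|exact: pos_seed].
have in_stage t : T t -> t < x -> stage f T pos x i (f t) by left; exists t.
have stage_in r : stage f T pos x i r -> (r < f x0)%R \/
    exists t, [/\ T t, r = f t & t < x].
  move=> [[t Tt [tx <-]]|[b jb [bx pb]]]; first by right; exists t.
  by left; have := pos_neg b; rewrite pb.
split.
- have [||r rP _] := seeds (f x0 - 1)%R (f x0); rewrite ?lexx//; first lra.
  by exists r.
- move=> r r' rP r'P rr'.
  have [r0|[s [[_ sl] rs sx]]] := stage_in r rP.
    have [||z zP /andP[rz]] := seeds r (Order.min r' (f x0)).
    + by rewrite lt_min rr'.
    + by rewrite ge_min lexx orbT.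
    + by rewrite lt_min => /andP[zr' _]; exists z; rewrite ?rz.
  have [r'0|[s' [Ts' rs' s'x]]] := stage_in r' r'P.
    have [||z zP /andP[rz zr']] := seeds r r' => //; first exact: ltW.
    by exists z; rewrite ?rz.
  rewrite rs rs' -f_lt in rr'.
  have [t Tt /andP[st ts']] := dense_right Td sl rr'.
  exists (f t); first by apply: in_stage => //; exact: lt_trans s'x.
  by rewrite rs rs' -!f_lt st.
- move=> r rP; have [r0|[s [[_ sl] -> sx]]] := stage_in r rP.
    by have [||z zP /andP[rz _]] := seeds r (f x0); rewrite ?lexx//; exists z.
  have [t Tt /andP[st tx]] := dense_right Td sl sx.
  by exists (f t); [exact: in_stage|rewrite -f_lt].
- move=> r _; set m := Order.min r (f x0).
  have [||z zP /andP[_ zr]] := seeds (m - 1)%R m.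
  + by rewrite gtrDl oppr_lt0.
  + by rewrite ge_min lexx orbT.
  + by exists z => //; move: zr; rewrite lt_min => /andP[].
Qed.

End Cases.

(* A one-element L is excluded: every maximal chain contains both the empty set
   and the whole of B n. *)
Theorem theorem5p1 (R : realType) (n : nat) (hn : (1 <= n)%N)
    (d : Order.disp_t) (L : orderType d)
    (hR : real_embeddable L R) (hL : complete_order L)
    (x0 : L) (hx0 : is_least x0) (hx0_non_isolated : non_isolated x0)
    (hL_nontrivial : exists x : L, x <> x0) :
  exists2 C : set (set (B n)),
    maximal_chain (copies (@B_lt n) `|` [set set0]) C
    & isomorphic (induced (fun X Y : set (B n) => X `<` Y) (A := C))
        (fun x y : L => (x < y)%O).
Proof.
have [f f_lt] := hR.
have nontriv : exists x : L, ~ is_least x.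
  have [x xx0] := hL_nontrivial; exists x => lx; apply: xx0.
  by apply/eqP; rewrite eq_le hx0 lx.
have [[c x0c jc]|nc] := pselect (exists2 c, (x0 < c)%O & jump_free x0 c).
  exact: chain_initial_interval jc.
apply: (chain_accumulating_jumps hn hL f_lt hx0) => // c x0c jc.
by apply: nc; exists c.
Qed.
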